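(* Let $n\ge1$, $k\ge1$, $m\ge0$ be integers. For $0\le i\le\min(k,n+m+1)$, $$\Gamma_i^{[n;1+m]\times k}=\sum_{j=0}^{n}2^{(n-j)(i-j)}\,a_j^{(n)}\prod_{l=1}^{j}(2^k-2^{i-l})\cdot\Gamma_{i-j}^{(1+m)\times k},$$ where $a_0^{(n)}=a_n^{(n)}=1$, and for $1\le j\le n-1$ $$a_j^{(n)}=\sum_{s=0}^{j-1}(-1)^s\prod_{l=0}^{j-(s+1)}\frac{2^{n+1}-2^l}{2^{j-s}-2^l}\cdot2^{s(n-j)+\frac{s(s+1)}{2}}+(-1)^j2^{jn-\frac{j(j-1)}{2}},$$ and where $\Gamma_{i-j}^{(1+m)\times k}=0$ if $i-j\notin\{0,1,\dots,\min(k,1+m)\}$.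
   Context: $\Gamma_i^{(1+m)\times k}$ is the number of $(1+m)\times k$ persymmetric matrices $(\alpha_{i+j-1})$ over $\mathbb{F}_2$ of rank $i$. $\Gamma_i^{[n;1+m]\times k}$ is the number of $(1+m+n)\times k$ matrices $\left[\begin{smallmatrix}A\\ B\end{smallmatrix}\right]$ over $\mathbb{F}_2$ of rank $i$, where $A$ is a $(1+m)\times k$ persymmetric matrix and $B$ is an arbitrary $n\times k$ matrix. *)

(* Defs.v *)
From mathcomp Require Import all_boot all_order all_algebra.

Set Implicit Arguments.
Unset Strict Implicit.
Unset Printing Implicit Defensive.

Import GRing.Theory Num.Theory.

Local Open Scope ring_scope.

(* The entry in row p and column q, both counted from 1, is alpha_(p+q-1), so
   an r x c persymmetric matrix is given by alpha_1, ..., alpha_(r+c-1).  Both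
   ordinals and the sequence alpha below are counted from 0. *)
Definition persymmetric (r c : nat) (A : 'M['F_2]_(r, c)) : bool :=
  [exists alpha : ((r + c).-1).-tuple 'F_2,
     A == \matrix_(p < r, q < c) alpha`_(p + q)].

(* The rank i ranges over int: the count vanishes at once for negative i and
   for i larger than the dimensions of the matrices. *)
Definition Gamma_persym (r c : nat) (i : int) : nat :=
  #|[set A : 'M['F_2]_(r, c) | persymmetric A & (\rank A)%:Z == i]|.

Definition Gamma_stacked (n r c : nat) (i : int) : nat :=
  #|[set M : 'M['F_2]_(r + n, c) |
       persymmetric (usubmx M) & (\rank M)%:Z == i]|.

(* Only meaningful for j <= n; both truncated subtractions in the exponents
   are then exact. *)
Definition a_coef (n j : nat) : rat :=
  if (j == 0)%N || (j == n) then 1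
  else \sum_(0 <= s < j)
         (-1) ^+ s
         * (\prod_(0 <= l < (j - s.+1).+1)
              ((2 ^+ n.+1 - 2 ^+ l) / (2 ^+ (j - s) - 2 ^+ l)))
         * 2 ^+ (s * (n - j) + (s * s.+1) %/ 2)
       + (-1) ^+ j * 2 ^+ (j * n - (j * j.-1) %/ 2).

(* Main.v *)
Require Import Defs.
From mathcomp Require Import all_boot all_order all_algebra.
From mathcomp Require Import mxabelem ring zify.

(* Append the n rows of B to A one at a time.  A new row either lies in the row
   space of the matrix built so far, of rank r (2^r choices), or raises the rank
   by one (2^k - 2^r choices).  By the q-Pascal rule, the number of B that raise
   the rank of A from i - j to i is
     2^((n - j)(i - j)) [n, j]_2 prod_(1 <= l <= j) (2^k - 2^(i - l)).
   The alternating sum defining a_j^(n) is the Gaussian binomial [n, j]_2,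
   obtained by iterating the other q-Pascal rule. *)

Import GRing.Theory Num.Theory Order.TTheory.

Local Open Scope ring_scope.

(** * Gaussian binomials and the alternating sum *)

Definition qbinom {R : fieldType} (q : R) (n j : nat) : R :=
  \prod_(0 <= l < j) ((q ^+ n - q ^+ l) / (q ^+ j - q ^+ l)).

Section QBinom.

Context {R : realFieldType} (q : R) (q_gt1 : 1 < q).

Let falling n j := \prod_(0 <= l < j) (q ^+ n - q ^+ l).

Let qbinomE n j : qbinom q n j = falling n j / falling j j.
Proof. by rewrite /qbinom big_split /= prodfV. Qed.

Let fallingS n j : falling n j.+1 = (q ^+ n - q ^+ j) * falling n j.
Proof. by rewrite /falling big_nat_recr //= mulrC. Qed.

(** Each factor but the one at [l = 0] yields a [q]: q^(n+1) - q^(l+1) = q (q^n - q^l). *)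
Let fallingSS n j :
  falling n.+1 j.+1 = (q ^+ n.+1 - 1) * q ^+ j * falling n j.
Proof.
rewrite /falling big_nat_recl //= expr0 -mulrA; congr (_ * _).
elim: j => [|j IHj]; first by rewrite !big_geq // expr0 mulr1.
by rewrite !big_nat_recr //= IHj !exprS; ring.
Qed.

Let q_neq0 : q != 0. Proof. by rewrite gt_eqF // (lt_trans ltr01). Qed.

Let qX_neq1 j : q ^+ j.+1 - 1 != 0.
Proof. by rewrite subr_eq0 gt_eqF // exprn_egt1. Qed.

Let falling_neq0 j : falling j j != 0.
Proof.
elim: j => [|j IHj]; first by rewrite /falling big_geq ?oner_neq0.
by rewrite fallingSS !mulf_neq0 ?expf_neq0.
Qed.

Lemma qbinom0 n : qbinom q n 0 = 1.
Proof. by rewrite /qbinom big_geq. Qed.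

Lemma qbinomnn n : qbinom q n n = 1.
Proof. by rewrite qbinomE divff. Qed.

Lemma qbinom_small n j : (n < j)%N -> qbinom q n j = 0.
Proof.
move=> ltnj; rewrite qbinomE; apply/eqP; rewrite mulf_eq0; apply/orP; left.
by rewrite /falling (bigD1_seq n) ?iota_uniq ?mem_index_iota //= subrr mul0r.
Qed.

(** The form of the q-Pascal rule that matches the recursion on appended rows. *)
Lemma qbinomSS n j :
  qbinom q n.+1 j.+1 = q ^+ j.+1 * qbinom q n j.+1 + qbinom q n j.
Proof.
rewrite !qbinomE !fallingSS fallingS.
have := qX_neq1 j; rewrite !exprS => q1.
by field; rewrite q1 falling_neq0 expf_neq0.
Qed.

Lemma qbinomSS_sub n j : (j <= n)%N ->
  qbinom q n.+1 j.+1 = qbinom q n j.+1 + q ^+ (n - j) * qbinom q n j.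
Proof.
move=> /subnK <-; move: (n - j)%N => d.
rewrite addnK !qbinomE !fallingSS fallingS.
have := qX_neq1 j; rewrite !exprS exprD => q1.
by field; rewrite q1 falling_neq0 expf_neq0.
Qed.

(* Unfolds [n, j] = [n + 1, j] - q^(n + 1 - j) [n, j - 1] down to [n, 0]. *)
Lemma qbinom_alternating n j : (j <= n)%N ->
  qbinom q n j = \sum_(0 <= s < j.+1) (-1) ^+ s * qbinom q n.+1 (j - s)
                   * q ^+ (s * (n - j) + (s * s.+1) %/ 2).
Proof.
elim: j => [|j IHj] lejn.
  by rewrite big_nat1 !qbinom0 !mul0n div0n !expr0 !mulr1.
rewrite big_nat_recl //= subn0 !mul0n div0n !expr0 mul1r mulr1.
rewrite qbinomSS_sub ?(ltnW lejn) // IHj ?(ltnW lejn) // mulr_sumr.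
(* Term s of the expansion of q^(n-j) [n, j] cancels term s + 1 of the target sum. *)
rewrite -addrA -big_split /= big1 ?addr0 // => s _.
have -> : (s.+1 * (n - j.+1) + (s.+1 * s.+2) %/ 2
           = (n - j) + (s * (n - j) + (s * s.+1) %/ 2))%N.
  have -> : (s.+1 * s.+2 = s.+1 * 2 + s * s.+1)%N by lia.
  rewrite divnMDl // -(subnSK lejn); lia.
by rewrite subSS exprS [q ^+ (n - j + _)]exprD; ring.
Qed.

End QBinom.

Lemma a_coefE n j : (j <= n)%N -> a_coef n j = qbinom 2 n j.
Proof.
move=> lejn; rewrite /a_coef.
case: eqP => [->|_] /=; first by rewrite qbinom0.
case: eqP => [->|_]; first by rewrite qbinomnn.
(* The isolated summand of [a_coef] is the term s = j, where [n+1, 0] = 1. *)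
rewrite [RHS]qbinom_alternating // big_nat_recr //= subnn qbinom0 mulr1.
congr (_ + _ * _ ^+ _).
  rewrite !big_nat; apply: eq_bigr => s /andP[_ ltsj].
  by rewrite subnSK.
(* What remains is j(n-j) + j(j+1)/2 = jn - j(j-1)/2; the halves are exact because j(j-1) is
   even. *)
have -> : (j * j.+1 = j * 2 + j * j.-1)%N by case: (j) => // ?; lia.
rewrite divnMDl //; have := leq_mul (leqnn j) lejn.
have : ((j * j.-1) %/ 2 <= j * j)%N.
  by rewrite (leq_trans (leq_div _ _)) // leq_mul // leq_pred.
have : (2 * ((j * j.-1) %/ 2) = j * j.-1)%N.
  by rewrite mulnC divnK // dvdn2 oddM; case: (j) => //= ?; rewrite andNb.
rewrite mulnBr; case: (j) => [|j'] /=; nia.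
Qed.

(** * Counting the ways to append rows to a fixed matrix *)

Section RowExtensions.

Context {F : finFieldType} {k : nat}.

Let q : rat := #|F|%:R.

Let q_gt1 : 1 < q. Proof. by rewrite ltr1n card_finNzRing_gt1. Qed.

Lemma card_submx_row {r} (A : 'M[F]_(r, k)) :
  #|[set v : 'rV_k | (v <= A)%MS]| = (#|F| ^ \rank A)%N.
Proof. by rewrite -card_rowg; apply: eq_card => v; rewrite !inE. Qed.

Lemma mxrank_adds_row {r} (A : 'M[F]_(r, k)) (v : 'rV_k) :
  \rank (A + v)%MS = (\rank A + ~~ (v <= A)%MS)%N.
Proof.
have [svA|nsvA] /= := boolP (v <= A)%MS.
  by rewrite addn0 (addsmx_idPl svA).
apply/eqP; rewrite addn1 eqn_leq; apply/andP; split.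
  rewrite (leq_trans (mxrank_adds_leqif A v).1) // -[leqRHS]addn1 leq_add2l.
  exact: rank_leq_row.
by apply: rank_ltmx; rewrite ltmxE addsmxSl addsmx_sub submx_refl.
Qed.

(** [(A + B)%MS] has the row space of [A] stacked on [B], but stays k x k however many rows are
    appended. *)
Definition row_extensions {r} (A : 'M[F]_(r, k)) (n i : nat) :=
  #|[set B : 'M[F]_(n, k) | \rank (A + B)%MS == i]|.

(** Rows inside the span of [A] keep the rank, those outside raise it by one. Indicators instead of
    cases allow summation over varying [A]. *)
Lemma row_extensions_row {r} (A : 'M[F]_(r, k)) (i : nat) :
  (row_extensions A 1 i)%:R =
  q ^+ i *+ (\rank A == i) + (q ^+ k - q ^+ \rank A) *+ ((\rank A).+1 == i).
Proof.
pose S := [set v : 'rV_k | (v <= A)%MS].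
have cS : #|S|%:R = q ^+ \rank A :> rat by rewrite card_submx_row natrX.
have cCS : #|~: S|%:R = q ^+ k - q ^+ \rank A.
  have := cardsC S; rewrite card_mx mul1n => /(congr1 (GRing.natmul (1 : rat))).
  by rewrite natrD natrX cS => <-; rewrite addrC addKr.
rewrite /row_extensions.
have [<-|ne1] := eqVneq.
  rewrite (gtn_eqF (ltnSn _)) addr0 -cS; congr _%:R; apply: eq_card => v.
  by rewrite !inE mxrank_adds_row -[X in _ == X]addn0 eqn_add2l eqb0 negbK.
have [<-|ne2] := eqVneq.
  rewrite add0r -cCS; congr _%:R; apply: eq_card => v.
  by rewrite !inE mxrank_adds_row -[X in _ == X]addn1 eqn_add2l eqb1.
rewrite !addr0 eq_card0 // => v; rewrite !inE mxrank_adds_row.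
by case: (_ <= _)%MS; rewrite ?addn0 ?addn1 ?(negPf ne1) ?(negPf ne2).
Qed.

Lemma row_extensionsS {r} (A : 'M[F]_(r, k)) (n i : nat) :
  row_extensions A n.+1 i =
  (\sum_(B : 'M[F]_(n, k)) row_extensions (A + B)%MS 1 i)%N.
Proof.
rewrite /row_extensions -sum1dep_card.
(* The single row goes on top because [n.+1] is [1 + n] by conversion; the order of rows does not
   affect the rank. *)
rewrite (reindex (fun p : 'M[F]_(n, k) * 'rV_k =>
  (col_mx p.2 p.1 : 'M_(1 + n, k)))) /=.
  rewrite (eq_bigl (fun p => true && (\rank (A + p.1 + p.2)%MS == i)));
    last first.
    move=> p; rewrite /= -addsmxA [(p.1 + _)%MS]addsmxC.
    by rewrite (adds_eqmx (eqmx_refl A) (addsmxE p.2 p.1)).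
  rewrite -(pair_big_dep xpredT (fun B v => \rank (A + B + v)%MS == i)
    (fun _ _ => 1%N)) /=.
  by apply: eq_bigr => B _; rewrite sum1dep_card.
exists (fun B : 'M_(1 + n, k) => (dsubmx B, usubmx B)) => [[B v]|B] _ /=.
  by rewrite col_mxKd col_mxKu.
exact: vsubmxK.
Qed.

Lemma row_extensions_small {r} (A : 'M[F]_(r, k)) (n i : nat) :
  (i < \rank A)%N -> row_extensions A n i = 0%N.
Proof.
move=> lt_i; apply: eq_card0 => B; rewrite !inE; apply/negbTE.
by rewrite gtn_eqF // (leq_trans lt_i) // mxrankS ?addsmxSl.
Qed.

Lemma row_extensionsS_rec {r} (A : 'M[F]_(r, k)) (n i : nat) :
  (row_extensions A n.+1 i)%:R =
  q ^+ i * (row_extensions A n i)%:R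
  + (if i is i'.+1 then (q ^+ k - q ^+ i') * (row_extensions A n i')%:R else 0).
Proof.
rewrite row_extensionsS natr_sum.
under eq_bigr do rewrite row_extensions_row.
rewrite big_split /=; congr (_ + _).
  rewrite /row_extensions -sum1dep_card natr_sum mulr_sumr [RHS]big_mkcond /=.
  by apply: eq_bigr => B _; rewrite mulr1; case: eqP.
case: i => [|i]; first by rewrite big1.
rewrite /row_extensions -sum1dep_card natr_sum mulr_sumr [RHS]big_mkcond /=.
by apply: eq_bigr => B _; rewrite mulr1 eqSS; case: eqP => [->|].
Qed.

Lemma row_extensions0 {r} (A : 'M[F]_(r, k)) (j : nat) :
  row_extensions A 0 (\rank A + j) = (j == 0%N).
Proof.
have rkB (B : 'M_(0, k)) : \rank (A + B)%MS = \rank A.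
  by rewrite flatmx0 addsmx0.
case: j => [|j] /=; [rewrite addn0|]; rewrite /row_extensions.
  rewrite (_ : [set B | _] = setT) ?cardsT ?card_mx ?mul0n //.
  by apply/setP => B; rewrite !inE rkB eqxx.
apply: eq_card0 => B.
by rewrite inE rkB -[X in X == _]addn0 eqn_add2l.
Qed.

(** Induction on [n] for all [j] at once, since the recursion calls on both [j] and [j.+1];
    [qbinomSS] merges the two terms. *)
Lemma card_row_extensions {r} (A : 'M[F]_(r, k)) (n j : nat) :
  (row_extensions A n (\rank A + j))%:R =
  q ^+ ((n - j) * \rank A) * qbinom q n j
  * \prod_(1 <= l < j.+1) (q ^+ k - q ^+ (\rank A + j - l)).
Proof.
elim: n j => [|n IHn] j.
  rewrite row_extensions0; case: j => [|j].
    by rewrite qbinom0 big_geq // mul0n !mulr1.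
  by rewrite qbinom_small // mulr0 mul0r.
rewrite row_extensionsS_rec IHn; case: j => [|j].
  rewrite addn0 !qbinom0 !big_geq // !mulr1 !subn0 mulSn exprD.
  (* Reaching rank [\rank A] from one less is impossible. *)
  case E: (\rank A) => [|r']; first by rewrite addr0.
  by rewrite row_extensions_small ?E // mulr0 addr0.
rewrite addnS IHn [\prod_(1 <= l < j.+2) _]big_nat_recl //= subSS subn0.
under [\prod_(1 <= i < j.+1) _]eq_bigr do rewrite subSS.
set P := \prod_(_ <= _ < _) _; rewrite qbinomSS //.
(* For j >= n the exponent [n - j.+1] truncates, but its term carries [n, j+1] = 0. *)
have [ltjn|lenj] := ltnP j n.
  by rewrite subSS -(subnSK ltjn) mulSn -addnS !exprD; ring.
by rewrite (qbinom_small _ n j.+1) // subSS !mulr0 mul0r !add0r; ring.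
Qed.

End RowExtensions.

(** * Summation over persymmetric matrices *)

Lemma Gamma_stackedE (n r k i : nat) :
  Gamma_stacked n r k i%:Z =
  (\sum_(A : 'M['F_2]_(r, k) | persymmetric A) row_extensions A n i)%N.
Proof.
rewrite /Gamma_stacked -sum1dep_card.
rewrite (reindex (fun p : 'M['F_2]_(r, k) * 'M_(n, k) => col_mx p.1 p.2)) /=.
  under eq_bigl => p do rewrite col_mxKu eqz_nat -addsmxE.
  rewrite -(pair_big_dep (@persymmetric r k)
    (fun A B => \rank (A + B)%MS == i) (fun _ _ => 1%N)) /=.
  by apply: eq_bigr => A _; rewrite sum1dep_card.
exists (fun M => (usubmx M, dsubmx M)) => [[A B]|M] _ /=.
  by rewrite col_mxKu col_mxKd.
exact: vsubmxK.
Qed.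

Theorem theorem1p9 (n k m i : nat) (hn : (1 <= n)%N) (hk : (1 <= k)%N)
    (hi : (i <= minn k (n + m + 1))%N) :
  (Gamma_stacked n (1 + m) k i%:Z)%:R =
  \sum_(0 <= j < n.+1)
     (2 : rat) ^ ((n%:Z - j%:Z) * (i%:Z - j%:Z))
     * a_coef n j
     * (\prod_(1 <= l < j.+1) (2 ^+ k - 2 ^ (i%:Z - l%:Z)))
     * (Gamma_persym (1 + m) k (i%:Z - j%:Z))%:R.
Proof.
rewrite Gamma_stackedE natr_sum /Gamma_persym.
under [RHS]eq_bigr => j _ do
  rewrite -sum1dep_card natr_sum mulr_sumr big_mkcondr /=.
(* With the sums swapped, the identity holds for each [A] separately: only j = i - [\rank A] can
   contribute. *)
rewrite exchange_big /=; apply: eq_bigr => A _.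
have [ltiA|leAi] := ltnP i (\rank A).
  rewrite row_extensions_small // big1 // => j _; case: eqP => // /eqP; lia.
have [j ->] : exists j, i = (\rank A + j)%N.
  by exists (i - \rank A)%N; rewrite subnKC.
rewrite card_row_extensions card_Fp //.
(* If j > n, this index lies outside the sum, and [n, j] = 0 on the left. *)
have [lejn|ltnj] := leqP j n; last first.
  rewrite qbinom_small // mulr0 mul0r big_nat big1 // => l lel.
  case: eqP => // /eqP; lia.
rewrite [RHS](bigD1_seq j) ?iota_uniq ?mem_index_iota //=.
rewrite [X in _ = _ + X]big1 ?addr0.
  have -> : ((\rank A + j)%N%:Z - j%:Z = (\rank A)%:Z) by lia.
  (* The integer exponents are nonnegative here, as l <= j <= n, and become natural powers. *)
  rewrite eqxx mulr1 -a_coefE // subzn // -PoszM -exprnP; congr (_ * _).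
  rewrite !big_nat; apply: eq_bigr => l lel; congr (_ - _).
  by rewrite subzn // (leq_trans _ (leq_addl _ _)) //; lia.
move=> l nelj; case: eqP => // /eqP; lia.
Qed.
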